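(* Let $\Pi_\mu$ be a probability measure on $C[0,1]$ with full sup-norm support and let $\Pi_\sigma$ be a probability measure on $[0,\infty)$ with full support. Let $\Pi$ be the prior induced on the set $\mathcal{F}$ of densities on $\mathbb{R}$ by $(\mu,\sigma)\mapsto f_{\mu,\sigma}$ when $(\mu,\sigma)\sim \Pi_\mu\otimes\Pi_\sigma$. Then the $L_1$ support of $\Pi$ contains every density $f_0$ on $\mathbb{R}$ which has a finite first moment and is non-zero almost everywhere on its support; that is, for every such $f_0$ and every $\epsilon>0$, $$(\Pi_\mu\otimes\Pi_\sigma)\Big\{(\mu,\sigma):\ \sigma>0,\ \int_{\mathbb{R}} |f_{\mu,\sigma}(y)-f_0(y)|\,dy<\epsilon\Big\}>0 .$$
   Context: $C[0,1]$ is the space of continuous functions $[0,1]\to\mathbb{R}$ with the supremum norm $\|\cdot\|_\infty$. $\mathcal{F}$ is the set of all probability densities on $\mathbb{R}$ with respect to Lebesgue measure. Let $\phi_\sigma(x)=\frac{1}{\sigma\sqrt{2\pi}}e^{-x^2/(2\sigma^2)}$. For $\mu\in C[0,1]$ and $\sigma>0$, $$f_{\mu,\sigma}(y)=\int_0^1\phi_\sigma(y-\mu(x))\,dx ,\qquad y\in\mathbb{R}.$$ ''$\Pi_\mu$ has full sup-norm support on $C[0,1]$'' means $\Pi_\mu(\mu:\|\mu-\mu^*\|_\infty<\epsilon)>0$ for every $\mu^*\in C[0,1]$ and $\epsilon>0$. ''$\Pi_\sigma$ has full support on $[0,\infty)$'' means every non-empty relatively open subset of $[0,\infty)$ has positive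 $\Pi_\sigma$-mass. ''Finite first moment'' means $\int_{\mathbb{R}}|x|f_0(x)\,dx<\infty$. A density belongs to the $L_1$ support of the prior if every $L_1$-ball of positive radius around it has positive prior mass. *)

(* Defs.v *)
From HB Require Import structures.
From mathcomp Require Import all_boot all_order all_algebra.
From mathcomp Require Import all_classical all_reals all_analysis.

Set Implicit Arguments.
Unset Strict Implicit.
Unset Printing Implicit Defensive.

Import Order.TTheory GRing.Theory Num.Theory.
Import numFieldNormedType.Exports.

Local Open Scope classical_set_scope.
Local Open Scope ring_scope.

Definition borel (T : ptopologicalType) := g_sigma_algebraType (@open T).

Notation unit_itv R := (set_type (`[0, 1]%classic : set R)).

Definition nonneg_itv (R : realType) : Type :=
  set_type (`[0, +oo[%classic : set R).

HB.instance Definition _ (R : realType) := Topological.on (nonneg_itv R).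

Fact nonneg_itv0_subproof (R : realType) :
  (0 : R) \in (`[0, +oo[%classic : set R).
Proof. by rewrite inE /= in_itv /= lexx. Qed.

HB.instance Definition _ (R : realType) :=
  isPointed.Build (nonneg_itv R) (SigSub (nonneg_itv0_subproof R)).

Definition C01 (R : realType) : Type := continuousType (unit_itv R) R.

Definition C01_fun (R : realType) (mu : C01 R) : unit_itv R -> R :=
  (mu : continuousType _ _).
Coercion C01_fun : C01 >-> Funclass.

HB.instance Definition _ (R : realType) := Choice.on (C01 R).

HB.instance Definition _ (R : realType) := isPointed.Build (C01 R)
  (mkcts (fun x => @cst_continuous (unit_itv R) R 0 x)
     : continuousType (unit_itv R) R).

(* The topology of uniform convergence; C01_nbhsP below shows that it is the
   one induced by the supremum norm. *)
HB.instance Definition _ (R : realType) :=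
  PseudoMetric.copy (C01 R)
    (initial_topology (@C01_fun R : C01 R -> arrow_uniform_type _ R)).

Definition sup_norm (R : realType) (f : unit_itv R -> R) : R :=
  sup (range (fun x => `|f x|)).

Lemma C01_ballE (R : realType) (mu nu : C01 R) (e : R) :
  ball mu e nu = (forall x : unit_itv R, `|mu x - nu x| < e) :> Prop.
Proof. by []. Qed.

Lemma C01_nbhsP (R : realType) (mu : C01 R) (A : set (C01 R)) :
  nbhs mu A <->
  exists2 e : R, 0 < e & [set nu : C01 R | sup_norm (nu \- mu) < e] `<=` A.
Proof.
have ne (h : unit_itv R -> R) : range (fun x => `|h x|) !=set0.
  have h0 : (0 : R) \in (`[0, 1]%classic : set R).
    by rewrite inE /= in_itv /= lexx ler01.
  by exists `|h (SigSub h0)|; exists (SigSub h0).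
have hub (f g : C01 R) : has_ubound (range (fun x => `|(f \- g) x|)).
  have cfg : continuous (fun x : unit_itv R => `|(f \- g) x|).
    move=> x; apply: (@continuous_comp _ _ _ (f \- g) (fun y : R => `|y|)).
      exact: (@continuousB R R _ f g x
        (@cts_fun _ _ (f : continuousType _ _) x)
        (@cts_fun _ _ (g : continuousType _ _) x)).
    exact: norm_continuous.
  move/(@subspace_valL_continuousP' _ _ _ (0 : R)) : cfg => cfg.
  have [c _ cmax] := EVT_max (@ler01 R) cfg.
  exists ('valL_0 (fun x : unit_itv R => `|(f \- g) x|) c) => _ [x _ <-].
  have xin : \val x \in `[0, 1]%R by have := set_valP x.
  apply: le_trans (cmax _ xin).
  by rewrite -[leLHS](congr1 (@^~ x)
    (valLK (0 : R) (fun t : unit_itv R => `|(f \- g) t|))).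
rewrite -nbhs_ballE; split.
- move=> [e /= e0 sub]; exists e => // nu /= h; apply: sub.
  rewrite /= C01_ballE => x; rewrite distrC; apply: le_lt_trans h.
  by apply: ub_le_sup => //; exists x.
- move=> [e e0 sub]; exists (e / 2) => /=; first by rewrite divr_gt0.
  move=> nu; rewrite /= C01_ballE => h; apply: sub => /=.
  apply: (@le_lt_trans _ _ (e / 2)); last by rewrite ltr_pdivrMr // ltr_pMr // ltr1n.
  apply: ge_sup => // _ [x _ <-]; apply: ltW.
  by rewrite distrC; exact: h.
Qed.

Definition sup_full_support (R : realType)
    (P : probability (borel (C01 R)) R) : Prop :=
  forall (mu : C01 R) (e : R), 0 < e ->
    (0 < P [set nu : C01 R | (sup_norm (nu \- mu) < e)%R])%E.

Definition full_support (R : realType)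
    (P : probability (borel (nonneg_itv R)) R) : Prop :=
  forall U : set (nonneg_itv R), open U -> U !=set0 -> (0 < P U)%E.

(* 'valL_0 mu extends mu : [0, 1] -> R to the line by 0.  The value for
   sigma = 0 is irrelevant: induced_prior only looks at sigma > 0. *)
Definition mixture_density (R : realType) (mu : C01 R) (sigma : R) (y : R) : R :=
  \int[lebesgue_measure]_(x in `[0, 1])
    normal_pdf 0 sigma (y - 'valL_0 (mu : unit_itv R -> R) x).

Definition is_density (R : realType) (f : R -> R) : Prop :=
  [/\ measurable_fun setT f, forall x, 0 <= f x &
      (\int[lebesgue_measure]_x (f x)%:E = 1)%E].

Definition finite_first_moment (R : realType) (f : R -> R) : Prop :=
  (\int[lebesgue_measure]_x (`|x| * f x)%R%:E < +oo)%E.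

(* The support of f is the closure of {f <> 0}; changing a density on a null set
   so that it vanishes off the support of its law makes the two usual notions of
   support agree. *)
Definition nonzero_ae_on_support (R : realType) (f : R -> R) : Prop :=
  {ae lebesgue_measure, forall x : R,
    closure [set y | f y != 0] x -> f x != 0}.

Definition L1_ball (R : realType) (f0 : R -> R) (e : R) : set (R -> R) :=
  [set f | (\int[lebesgue_measure]_y `|f y - f0 y|%R%:E < e%:E)%E].

(* The law of mixture_density mu sigma, restricted to the event sigma > 0; the
   remaining event sigma = 0 defines no density. *)
Definition induced_prior (R : realType) (Pmu : probability (borel (C01 R)) R)
    (Psigma : probability (borel (nonneg_itv R)) R) (B : set (R -> R)) :
    \bar R :=
  (Pmu \x Psigma)%E [set p : C01 R * nonneg_itv R |
    0 < \val p.2 /\ B (mixture_density p.1 (\val p.2))].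

Definition L1_support (R : realType) (Pi : set (R -> R) -> \bar R) :
    set (R -> R) :=
  [set f0 | forall e : R, 0 < e -> (0 < Pi (L1_ball f0 e))%E].

(* Main.v *)
Require Import Defs.
From mathcomp Require Import all_boot all_order all_algebra.
From mathcomp Require Import all_classical all_reals all_analysis.
From mathcomp Require Import ring lra measurable_realfun.

(** Let [A] be the set of parameters [(mu, s)] with [s > 0] whose mixture lies
    in the given L1 ball around [f0]. It suffices that [A] is nonempty and open:
    it then contains the product of a sup-norm ball and an interval, each of
    positive mass under its own prior
    ([product_measure1_rectangle_gt0]).

    Openness holds because the mixture depends continuously on its parameters
    in L1 ([mixture_density_cvg], [mixture_density_near]): bounded convergence
    on the unit interval gives pointwise convergence of the densities, and for
    densities pointwise convergence implies L1 convergence ([scheffe]).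

    For nonemptiness, [f0] is first approximated in L1 by a density [g] that is
    continuous and positive on a segment [[a, b]] and zero outside
    ([density_approx_continuous]). The quantile function of [g] is then a
    continuous function [mu] on the unit interval. Under the uniform law on that
    interval [mu] has density [g], so that its mixture of scale [s] is the
    convolution of [g] with the centred normal density of scale [s]
    ([quantile_mixture]). These convolutions converge to [g] at every point of
    continuity as [s] tends to zero ([normal_smoothing_cvg]), hence in L1, again
    by Scheffe's lemma ([mixture_approx_continuous]). *)

Set Implicit Arguments.
Unset Strict Implicit.
Unset Printing Implicit Defensive.

Import Order.TTheory GRing.Theory Num.Theory.
Import numFieldNormedType.Exports.

Local Open Scope classical_set_scope.
Local Open Scope ring_scope.

Section mixtures.
Context {R : realType}.
Local Notation leb := (@lebesgue_measure R).
Local Notation I01 := (`[0%R, 1%R]%classic : set R).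
Implicit Types (m : R -> R) (s y t d : R).

(** * L1 convergence of densities *)

Lemma ge0_cvge0 (u : (\bar R)^nat) : (forall n, 0 <= u n)%E ->
  (forall e : R, 0 < e -> \forall n \near \oo, (u n <= e%:E)%E) ->
  (u n @[n --> \oo] --> 0)%E.
Proof.
move=> u0 ue; apply/fine_cvgP; split.
  apply: filterS (ue _ ltr01) => n un.
  by rewrite ge0_fin_numE// (le_lt_trans un)// ltry.
apply/cvgrPdist_le => e e0; apply: filterS (ue _ e0) => n un /=.
rewrite sub0r normrN ger0_norm ?fine_ge0// -lee_fin fineK//.
by rewrite ge0_fin_numE// (le_lt_trans un)// ltry.
Qed.

Lemma cvge0_near_lt (u : (\bar R)^nat) (e : R) :
  (u n @[n --> \oo] --> 0)%E -> 0 < e -> \forall n \near \oo, (u n < e%:E)%E.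
Proof.
move=> /fine_cvgP[ufin /cvgr_lt/(_ _)] u0 e0.
near=> n; rewrite -[u n]fineK ?lte_fin; last by near: n.
by near: n; exact: u0.
Unshelve. all: by end_near. Qed.

Lemma density_integrable (f : R -> R) : is_density f ->
  leb.-integrable setT (EFin \o f).
Proof.
move=> [mf f0 intf]; apply/integrableP; split; first exact/measurable_EFinP.
under eq_integral do rewrite /= ger0_norm//.
by rewrite intf ltry.
Qed.

Definition L1dist (f g : R -> R) : \bar R :=
  (\int[leb]_y `|f y - g y|%:E)%E.

Lemma L1distC f g : L1dist f g = L1dist g f.
Proof. by apply: eq_integral => y _; rewrite distrC. Qed.

Lemma L1dist_triangle f g h : measurable_fun setT f -> measurable_fun setT g ->
  measurable_fun setT h -> (L1dist f h <= L1dist f g + L1dist g h)%E.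
Proof.
move=> mf mg mh.
have mN (u v : R -> R) : measurable_fun setT u -> measurable_fun setT v ->
    measurable_fun setT (fun y => `|u y - v y|%:E).
  move=> mu mv; apply/measurable_EFinP; apply: measurableT_comp => //.
  exact: measurable_funB.
rewrite /L1dist -ge0_integralD//; [|exact: mN|exact: mN].
apply: ge0_le_integral => //.
- exact: mN.
- by apply: emeasurable_funD; exact: mN.
- by move=> y _; rewrite -EFinD lee_fin ler_distD.
Qed.

(** Scheffe's lemma. Two densities have the same mass, so their L1 distance is
    twice the integral of the positive part of [f - f_n]; that positive part
    is dominated by [f] itself, so dominated convergence applies. *)
Lemma scheffe (f_ : (R -> R)^nat) (f : R -> R) :
  (forall n, is_density (f_ n)) -> is_density f ->
  {ae leb, forall x, f_ ^~ x @ \oo --> f x} ->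
  (L1dist (f_ n) f @[n --> \oo] --> 0)%E.
Proof.
move=> df_ df f_f.
pose p n x := Num.max (f x - f_ n x) 0.
have mf := let: And3 m _ _ := df in m.
have mf_ n := let: And3 m _ _ := df_ n in m.
have mp n : measurable_fun setT (p n).
  by apply: measurable_maxr => //; exact: measurable_funB.
have p_ge0 n x : 0 <= p n x by rewrite /p le_max lexx orbT.
have p_le n x : p n x <= f x.
  case: df => _ f0 _; case: (df_ n) => _ fn0 _.
  by rewrite /p ge_max f0 gerBl fn0.
have Ep n : L1dist (f_ n) f = (2%:E * \int[leb]_x (p n x)%:E)%E.
  have ip : leb.-integrable setT (EFin \o p n).
    apply: le_integrable (density_integrable df) => //.
    by apply/measurable_EFinP; exact: mp.
    move=> x _ /=; rewrite lee_fin !ger0_norm ?p_le//.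
    exact: le_trans (p_ge0 _ _) (p_le _ _).
  rewrite -integralZl//.
  transitivity (\int[leb]_x ((f_ n x)%:E - (f x)%:E + 2%:E * (p n x)%:E))%E.
    apply: eq_integral => x _; rewrite -EFinB -EFinM -EFinD; congr EFin.
    rewrite /p; have [h|h] := leP (f_ n x) (f x).
      by rewrite (max_idPl _) ?subr_ge0// ler0_norm ?subr_le0//; lra.
    by rewrite (max_idPr _) ?subr_le0 1?ltW// gtr0_norm ?subr_gt0//; lra.
  rewrite integralD//; last 2 first.
  - by apply: integrableB => //; exact: density_integrable.
  - exact: integrableZl.
  rewrite integralB//; [|exact: (density_integrable (df_ n))
                        |exact: (density_integrable df)].
  case: df => _ _ ->; case: (df_ n) => _ _ ->.
  by rewrite subee// add0e.
have [] := @dominated_convergence _ _ R leb setT measurableT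
  (fun n => EFin \o p n) (cst 0%E) (EFin \o f) => //.
- by move=> n; apply/measurable_EFinP; exact: mp.
- move: f_f; apply: filterS; first exact: (ae_filter_ringOfSetsType leb).
  move=> x fx _ /=; apply: cvg_EFin; first exact: nearW.
  apply: (@squeeze_cvgr _ _ _ _ (cst 0) (fun n => `|f x - f_ n x|)).
  + by apply: nearW => n; rewrite /= p_ge0 /= ge_max ler_norm normr_ge0.
  + exact: cvg_cst.
  + rewrite -(normr0 R) -(subrr (f x)); apply: cvg_norm.
    by apply: cvgB => //; exact: cvg_cst.
- exact: density_integrable.
- by apply: aeW => x n _; rewrite /= lee_fin ger0_norm ?p_le ?p_ge0.
move=> _ _; rewrite integral0 => /(cvgeZl (isT : (2%:E : \bar R) \is a fin_num)).
by rewrite mule0; under [X in _ -> X @ _ --> _]eq_fun do rewrite Ep.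
Qed.

(** * Normal location mixtures over the unit interval *)

Definition normal_mixture m s y : R :=
  \int[leb]_(x in I01) normal_pdf 0 s (y - m x).

Lemma normal_pdf_translate s a y : s != 0 ->
  normal_pdf 0 s (y - a) = normal_pdf a s y.
Proof. by move=> s0; rewrite !normal_pdfE// /normal_fun subr0. Qed.

Lemma leb_unit : leb I01 = 1%E.
Proof. by rewrite lebesgue_measure_itv /= lte_fin ltr01 sube0. Qed.

Lemma measurable_mix_kernel m s y : measurable_fun I01 m ->
  measurable_fun I01 (fun x => normal_pdf 0 s (y - m x)).
Proof.
move=> mm; apply: measurableT_comp; first exact: measurable_normal_pdf.
by apply: measurable_funB.
Qed.

Lemma integrable_mix_kernel m s y : s != 0 -> measurable_fun I01 m ->
  leb.-integrable I01 (fun x => (normal_pdf 0 s (y - m x))%:E).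
Proof.
move=> s0 mm; apply: measurable_bounded_integrable => //.
- by rewrite [ltLHS]leb_unit ltry.
- exact: measurable_mix_kernel.
- exists (normal_peak s); split; [exact: num_real|move=> M sM x /= _].
  by rewrite ger0_norm ?normal_pdf_ge0// (le_trans _ (ltW sM))// normal_pdf_ub.
Qed.

Lemma normal_mixtureE m s y : s != 0 -> measurable_fun I01 m ->
  ((normal_mixture m s y)%:E = \int[leb]_(x in I01) (normal_pdf 0 s (y - m x))%:E)%E.
Proof.
move=> s0 mm; rewrite /normal_mixture /Rintegral fineK//.
by apply: integrable_fin_num => //; exact: integrable_mix_kernel.
Qed.

Lemma normal_mixture_ge0 m s y : 0 <= normal_mixture m s y.
Proof. by apply: Rintegral_ge0 => x _; exact: normal_pdf_ge0. Qed.

(** By Tonelli, the mass of the mixture is the average over the unit interval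
    of the masses of normal densities. *)
Lemma normal_mixture_density m s : s != 0 -> measurable_fun I01 m ->
  is_density (normal_mixture m s).
Proof.
move=> s0 mm.
(* Tonelli is applied on the whole plane: the indicator cuts the integral
   down to the unit interval. *)
pose k (z : R * R) := ((normal_pdf 0 s (z.2 - (m \_ I01) z.1)) *
  \1_I01 z.1)%:E.
have mk : measurable_fun setT k.
  apply/measurable_EFinP; apply: measurable_funM.
    apply: measurableT_comp; first exact: measurable_normal_pdf.
    apply: measurable_funB => //.
    apply: (measurableT_comp (f := m \_ I01)) => //.
    exact/(measurable_restrictT _ _).1.
  have mI : measurable_fun setT (\1_I01 : R -> R) by exact: measurable_indic.
  exact: (measurableT_comp mI measurable_fst).
have k0 z : (0 <= k z)%E by rewrite lee_fin mulr_ge0 ?normal_pdf_ge0.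
have mixk y : ((normal_mixture m s y)%:E = \int[leb]_x k (x, y))%E.
  rewrite normal_mixtureE// integral_mkcond; apply: eq_integral => x _.
  rewrite /k /= !patchE indicE; case: ifP => _; by rewrite ?mulr1 ?mulr0.
split.
- apply/measurable_EFinP; rewrite (_ : _ \o _ = fubini_G leb k).
    exact: measurable_fun_fubini_tonelli_G.
  by apply/funext => y; rewrite /= mixk.
- by move=> y; exact: normal_mixture_ge0.
under eq_integral do rewrite mixk.
transitivity (\int[leb]_x \int[leb]_y k (x, y))%E.
  exact/esym/(@fubini_tonelli _ _ _ _ R leb leb k mk k0).
rewrite -leb_unit -(setIT I01) -integral_indic//; apply: eq_integral => x _.
rewrite /k /= !patchE indicE; case: ifP => _ /=; last first.
  by under eq_integral do rewrite mulr0; rewrite integral0.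
under eq_integral do rewrite mulr1 normal_pdf_translate//.
exact: integral_normal_pdf.
Qed.

(** The lower bound [s / 2] on the scales bounds all kernels by the peak of
    the normal density of scale [s / 2], which is integrable on the unit
    interval. *)
Lemma normal_mixture_cvg (m_ : (R -> R)^nat) m (s_ : R^nat) s y :
  (forall n, measurable_fun I01 (m_ n)) -> measurable_fun I01 m ->
  (forall x, I01 x -> m_ ^~ x @ \oo --> m x) ->
  0 < s -> (forall n, s / 2 <= s_ n) -> s_ @ \oo --> s ->
  normal_mixture (m_ n) (s_ n) y @[n --> \oo] --> normal_mixture m s y.
Proof.
move=> mm_ mm m_m s0 s_ge s_s.
have s_gt0 n : 0 < s_ n by apply: lt_le_trans (s_ge n); rewrite divr_gt0.
have sn0 n : s_ n != 0 by rewrite gt_eqF.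
have sneq0 : s != 0 by rewrite gt_eqF.
have [] := @dominated_convergence _ _ R leb I01 (measurable_itv _)
  (fun n => (fun x => (normal_pdf 0 (s_ n) (y - m_ n x))%:E))
  (fun x => (normal_pdf 0 s (y - m x))%:E)
  (cst (normal_peak (s / 2))%:E).
- by move=> n; apply/measurable_EFinP; exact: measurable_mix_kernel.
- by apply/measurable_EFinP; exact: measurable_mix_kernel.
- apply: aeW => x /= x01; apply: cvg_EFin; first exact: nearW.
  rewrite (_ : _ \o _ = fun n => normal_peak (s_ n) * normal_fun (m_ n x) (s_ n) y).
    rewrite normal_pdf_translate// normal_pdfE//.
    have ss2 : s_ n ^+ 2 @[n --> \oo] --> s ^+ 2 
      by rewrite expr2; under eq_fun do rewrite expr2; exact: cvgM.
    apply: cvgM.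
    + apply: cvgV; first by rewrite gt_eqF// sqrtr_gt0 pmulrn_lgt0//
        mulr_gt0 ?exprn_gt0 ?pi_gt0.
      apply: (@cvg_comp _ _ _ (fun n => s_ n ^+ 2 * pi *+ 2) Num.sqrt _
        (nbhs (s ^+ 2 * pi *+ 2))); last exact: sqrt_continuous.
      by apply: cvgMn; apply: cvgM => //; exact: cvg_cst.
    + apply: (@cvg_comp _ _ _ _ expR _
        (nbhs (- (y - m x) ^+ 2 / (s ^+ 2 *+ 2)))); last exact: continuous_expR.
      apply: cvgM; last first.
        apply: cvgV; first by rewrite gt_eqF// pmulrn_lgt0// exprn_gt0.
        exact: cvgMn.
      apply: cvgN; rewrite expr2; under eq_fun do rewrite expr2.
      by apply: cvgM; (apply: cvgB; [exact: cvg_cst|exact: m_m]).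
  by apply/funext => n /=; rewrite normal_pdf_translate// normal_pdfE.
- apply/measurable_bounded_integrable => //.
    by rewrite [ltLHS]leb_unit ltry.
  exists (normal_peak (s / 2)); split; [exact: num_real|move=> M sM x /= _].
  by rewrite (le_trans _ (ltW sM))// ger0_norm// normal_peak_ge0.
- apply: aeW => x n _ /=; rewrite lee_fin ger0_norm ?normal_pdf_ge0//.
  apply: le_trans (normal_pdf_ub _ _ (sn0 n)) _.
  have pos t : 0 < t -> 0 < t ^+ 2 * pi *+ 2 :> R.
    by move=> t0; rewrite pmulrn_lgt0// mulr_gt0 ?exprn_gt0 ?pi_gt0.
  have s20 : 0 < s / 2 by rewrite divr_gt0.
  rewrite /normal_peak lef_pV2 ?posrE ?sqrtr_gt0 ?pos//.
  rewrite ler_wsqrtr// lerMn2r ler_pM2r ?pi_gt0//.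
  by rewrite ler_sqr ?nnegrE ?s_ge ?ltW.
move=> _ _; rewrite -normal_mixtureE// => h.
exact: fine_cvg h.
Qed.

(** * Smoothing by a normal kernel of vanishing variance *)

Lemma normal_pdf_sym s y t : s != 0 -> normal_pdf 0 s (y - t) = normal_pdf y s t.
Proof.
move=> s0; rewrite !normal_pdfE// /normal_fun subr0.
by rewrite -sqrrN opprB.
Qed.

(** Away from its centre, a normal density of small scale is a small multiple
    of the normal density of twice that scale. This bounds tail integrals
    through the total mass of a normal density, without computing them. *)
Lemma normal_pdf_tail s d y t : 0 < s -> 0 < d -> d <= `|t - y| ->
  normal_pdf y s t <= (16 * s ^+ 2 / d ^+ 2) * normal_pdf y (2 * s) t.
Proof.
move=> s0 d0 du.
have sn0 : s != 0 by rewrite gt_eqF.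
have s2n0 : 2 * s != 0 by rewrite mulf_neq0.
rewrite !normal_pdfE// /normal_fun.
have -> : normal_peak (2 * s) = normal_peak s / 2.
  rewrite /normal_peak -invfM; congr (_ ^-1).
  have -> : (2 * s) ^+ 2 * pi *+ 2 = (2 ^+ 2) * (s ^+ 2 * pi *+ 2) by ring.
  by rewrite sqrtrM ?exprn_ge0// sqrtr_sqr ger0_norm// mulrC.
(* The two exponents are [- 4 * a] and [- a]; the quotient [exp (- 3 * a)]
   is at most [a^-1], which the distance [d] to the centre controls. *)
set a := (t - y) ^+ 2 / (8 * s ^+ 2).
have d2 : d ^+ 2 <= (t - y) ^+ 2.
  by rewrite -[leRHS]real_normK ?num_real// ler_sqr// nnegrE ltW.
have a0 : 0 < a.
  apply: divr_gt0; last by rewrite mulr_gt0// exprn_gt0.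
  by apply: lt_le_trans d2; rewrite exprn_gt0.
have -> : - (t - y) ^+ 2 / (s ^+ 2 *+ 2) = - a + - (3 * a) by rewrite /a; field.
have -> : - (t - y) ^+ 2 / ((2 * s) ^+ 2 *+ 2) = - a by rewrite /a; field.
rewrite expRD [expR (- (3 * a))]expRN.
have h : (expR (3 * a))^-1 <= 8 * s ^+ 2 / d ^+ 2.
  apply: (@le_trans _ _ a^-1).
    rewrite lef_pV2 ?posrE ?expR_gt0//.
    by apply: le_trans (expR_ge1Dx _); lra.
  rewrite /a invf_div ler_pM2l ?mulr_gt0 ?exprn_gt0//.
  by rewrite lef_pV2 // posrE ?(lt_le_trans _ d2)// exprn_gt0.
have -> : 16 * s ^+ 2 / d ^+ 2 * (normal_peak s / 2 * expR (- a)) =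
  normal_peak s * (expR (- a) * (8 * s ^+ 2 / d ^+ 2)).
  by field; rewrite gt_eqF.
rewrite ler_wpM2l ?normal_peak_ge0// ler_wpM2l ?expR_ge0 //.
Qed.

(** Normal kernels form an approximate identity: near [y] the function [h] is
    within [e] of [h y], and further away its oscillation, at most [2 * K], is
    integrated against a kernel that [normal_pdf_tail] makes negligible. *)
Lemma normal_smoothing_cvg (h : R -> R) (K : R) (s_ : R^nat) y :
  measurable_fun setT h -> (forall t, `|h t| <= K) ->
  {for y, continuous h} -> (forall n, 0 < s_ n) -> s_ @ \oo --> 0 ->
  (\int[leb]_t (normal_pdf y (s_ n) t * h t)%:E @[n --> \oo] --> (h y)%:E)%E.
Proof.
move=> mh hK ch s0 s_s.
have sn0 n : s_ n != 0 by rewrite gt_eqF.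
have mpdf s : measurable_fun setT (normal_pdf y s) := measurable_normal_pdf y s.
have int_pdf n (k : R -> R) (B : R) : measurable_fun setT k ->
    (forall t, `|k t| <= B) ->
    leb.-integrable setT (fun t => (normal_pdf y (s_ n) t * k t)%:E).
  move=> mk kB; have B0 : 0 <= B by apply: le_trans (kB 0).
  apply: le_integrable
    (integrableZl measurableT B (integrable_normal_pdf y (s_ n))) => //.
    by apply/measurable_EFinP; apply: measurable_funM => //; exact: mpdf.
  move=> t _ /=; rewrite lee_fin !normrM mulrC (ger0_norm B0).
  by rewrite ler_wpM2r.
apply/sube_cvg0 => //; apply/cvg_abse0P.
pose E (e d : R) n := (e%:E + (2 * K * (16 * s_ n ^+ 2 / d ^+ 2))%:E)%E.
have bound e : 0 < e -> exists2 d, 0 < d & forall n,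
  (`| \int[leb]_t (normal_pdf y (s_ n) t * h t)%:E - (h y)%:E | <= E e d n)%E.
  move=> e0.
  have [d d0 hd] : exists2 d, 0 < d & forall t, `|t - y| < d -> `|h t - h y| <= e.
    move/cvgrPdist_le : ch => /(_ e e0) [d /= d0 dh]; exists d => // t ty.
    by rewrite distrC; apply: dh; rewrite /= distrC.
  exists d => // n.
  have -> : (h y)%:E = (\int[leb]_t (normal_pdf y (s_ n) t * h y)%:E)%E.
    under eq_integral do rewrite EFinM.
    rewrite integralZr//; last exact: integrable_normal_pdf.
    by rewrite integral_normal_pdf mul1e.
  have ihy : leb.-integrable setT (fun t => (normal_pdf y (s_ n) t * h y)%:E).
    exact: (int_pdf n (cst (h y)) K (measurable_cst _) (fun=> hK y)).
  have ih := int_pdf n h K mh hK.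
  have idiff := integrableB measurableT ih ihy.
  rewrite -integralB//.
  apply: le_trans (le_abse_integral _ _ _) _ => //.
    exact: measurable_int idiff.
  pose c := 2 * K * (16 * s_ n ^+ 2 / d ^+ 2).
  have K0 : 0 <= K by apply: le_trans (hK 0).
  have c0 : 0 <= c.
    by rewrite /c !mulr_ge0// ?invr_ge0 ?exprn_ge0// ltW// s0.
  have ib s b : leb.-integrable setT (fun t => b%:E * (normal_pdf y s t)%:E)%E.
    by apply: integrableZl => //; exact: integrable_normal_pdf.
  apply: (@le_trans _ _ (\int[leb]_t (e%:E * (normal_pdf y (s_ n) t)%:E +
     c%:E * (normal_pdf y (2 * s_ n) t)%:E))%E).
    apply: ge0_le_integral => //.
    - apply: measurableT_comp => //.
      exact: measurable_int idiff.
    - by apply: (measurable_int leb); apply: integrableD.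
    move=> t _; rewrite -!EFinM -EFinB -EFinD lee_fin -mulrBr normrM.
    rewrite ger0_norm ?normal_pdf_ge0//.
    have [ty|ty] := ltP `|t - y| d.
      rewrite -[leLHS]addr0 lerD ?(mulr_ge0 c0) ?normal_pdf_ge0//.
      by rewrite mulrC ler_wpM2r ?normal_pdf_ge0// hd.
    rewrite -[leLHS]add0r lerD ?(mulr_ge0 (ltW e0)) ?normal_pdf_ge0//.
    rewrite mulrC /c -[leRHS]mulrA ler_pM ?normal_pdf_ge0 ?normal_pdf_tail ?normr_ge0//.
    by rewrite (le_trans (ler_normB _ _))// mulr2n mulrDl mul1r lerD.
  rewrite integralD//.
  rewrite !integralZl//; [|exact: integrable_normal_pdf|exact: integrable_normal_pdf].
  by rewrite !integral_normal_pdf !mule1.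
apply: ge0_cvge0 => [n|e e0]; first exact: abse_ge0.
have e20 : 0 < e / 2 by rewrite divr_gt0.
have [d d0 Ed] := bound _ e20.
have : 2 * K * (16 * (s_ n * s_ n) / d ^+ 2) @[n --> \oo] -->
    2 * K * (16 * (0 * 0) / d ^+ 2).
  apply: cvgM; first exact: cvg_cst.
  apply: cvgM; last exact: cvg_cst.
  by apply: cvgM; [exact: cvg_cst|exact: cvgM].
rewrite !mulr0 mul0r mulr0 => /cvgr_le /(_ (e / 2) e20); apply: filterS => n /= he.
apply: le_trans (Ed n) _; rewrite /E -EFinD lee_fin.
by rewrite expr2 [leRHS](splitr e) lerD2l.
Qed.

(** * Mixtures indexed by continuous functions *)

(** The extension by zero to the line of a function on the unit interval, the
    one under the integral in [mixture_density]. *)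
Definition C01_ext (mu : C01 R) : R -> R := 'valL_0 (mu : unit_itv R -> R).

Lemma C01_extE (mu : C01 R) (x : unit_itv R) : C01_ext mu (\val x) = mu x.
Proof. exact: (congr1 (@^~ x) (valLK (0 : R) (mu : unit_itv R -> R))). Qed.

Lemma C01_continuous (mu : C01 R) : continuous (mu : unit_itv R -> R).
Proof. exact: (@cts_fun _ _ (mu : continuousType _ _)). Qed.

Lemma measurable_C01_ext (mu : C01 R) : measurable_fun I01 (C01_ext mu).
Proof.
apply: subspace_continuous_measurable_fun => //.
exact/(@subspace_valL_continuousP' _ _ _ (0 : R))/C01_continuous.
Qed.

Lemma mixture_density_is_density (mu : C01 R) (s : R) : 0 < s ->
  is_density (mixture_density mu s).
Proof.
by move=> s0; apply: normal_mixture_density; rewrite ?gt_eqF//; exact: measurable_C01_ext.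
Qed.

(** Pointwise convergence of the locations suffices: it gives pointwise
    convergence of the mixture densities, which Scheffe's lemma turns into
    L1 convergence. *)
Lemma mixture_density_cvg (mu_ : (C01 R)^nat) (mu : C01 R) (s_ : R^nat) (s : R) :
  (forall x, mu_ ^~ x @ \oo --> mu x) ->
  0 < s -> (forall n, s / 2 <= s_ n) -> s_ @ \oo --> s ->
  (L1dist (mixture_density (mu_ n) (s_ n)) (mixture_density mu s)
    @[n --> \oo] --> 0)%E.
Proof.
move=> mu_mu s0 s_ge s_s.
apply: scheffe.
- move=> n; apply: mixture_density_is_density.
  by apply: lt_le_trans (s_ge n); rewrite divr_gt0.
- exact: mixture_density_is_density.
- apply: aeW => y; apply: normal_mixture_cvg => //.
  + by move=> n; exact: measurable_C01_ext.
  + exact: measurable_C01_ext.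
  + move=> x x01; pose z : unit_itv R := SigSub (mem_set x01).
    have E (nu : C01 R) : C01_ext nu x = nu z by rewrite -C01_extE SubK.
    rewrite [X in X @ \oo --> _](_ : _ = mu_ ^~ z); last first.
      by apply/funext => n; exact: E.
    by rewrite [X in _ --> X](_ : _ = mu z); [exact: mu_mu|exact: E].
Qed.

(** The parameters whose mixture lies in a fixed L1 ball form an open set, for
    the uniform distance in [mu] and the usual one in [s]. If no [d] worked, a
    sequence of bad parameters would converge to [(mu, s)], against
    [mixture_density_cvg]. *)
Lemma mixture_density_near (f0 : R -> R) (e : R) (mu : C01 R) (s : R) :
  measurable_fun setT f0 -> 0 < s ->
  (L1dist (mixture_density mu s) f0 < e%:E)%E ->
  exists2 d : R, 0 < d & forall (nu : C01 R) (t : R),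
    (forall x, `|nu x - mu x| < d) -> `|t - s| < d ->
    0 < t /\ (L1dist (mixture_density nu t) f0 < e%:E)%E.
Proof.
move=> mf0 s0 hlt; apply: contrapT => hN.
(* The cap [s / 2] keeps the bad scales away from zero, as
   [mixture_density_cvg] requires. *)
pose d n := Num.min (s / 2) n.+1%:R^-1.
have d0 n : 0 < d n by rewrite /d lt_min divr_gt0//= invr_gt0.
have /choice [g hg] n : exists p : C01 R * R, [/\ forall x, `|p.1 x - mu x| < d n,
    `|p.2 - s| < d n & ~ (0 < p.2 /\
    (L1dist (mixture_density p.1 p.2) f0 < e%:E)%E)].
  apply: contrapT => hn; apply: hN; exists (d n); first exact: d0.
  move=> nu t h1 h2.
  by apply: contrapT => h3; apply: hn; exists (nu, t); split.
pose mu_ n := (g n).1; pose s_ n := (g n).2.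
have d_cvg : d @ \oo --> (0 : R).
  apply: (@squeeze_cvgr _ _ _ _ (cst 0) (fun n => n.+1%:R^-1)).
  - by apply: nearW => n; rewrite /= ltW//= /d ge_min lexx orbT.
  - exact: cvg_cst.
  - exact: cvg_harmonic.
have s_ge n : s / 2 <= s_ n.
  have [_ + _] := hg n; rewrite ltr_norml => /andP[+ _].
  have : d n <= s / 2 by rewrite /d ge_min lexx.
  rewrite -/(s_ n); lra.
have near0 (u : R^nat) (l : R) : (forall n, `|u n - l| < d n) -> u @ \oo --> l.
  move=> ul; apply/cvgrPdist_le => eps eps0.
  move/cvgr_le : d_cvg => /(_ eps eps0); apply: filterS => n /=.
  by rewrite distrC; apply: le_trans; rewrite ltW.
have mumu x : mu_ ^~ x @ \oo --> mu x.
  by apply: near0 => n; have [] := hg n.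
have ss : s_ @ \oo --> s by apply: near0 => n; have [] := hg n.
have cv := mixture_density_cvg mumu s0 s_ge ss.
have mm (nu : C01 R) t : 0 < t -> measurable_fun setT (mixture_density nu t).
  by move=> /(mixture_density_is_density nu) [].
have s_gt0 n : 0 < s_ n by apply: lt_le_trans (s_ge n); rewrite divr_gt0.
have fin : L1dist (mixture_density mu s) f0 \is a fin_num.
  by rewrite ge0_fin_numE ?(lt_trans hlt) ?ltry//; exact: integral_ge0.
have [n] : exists n, (L1dist (mixture_density (mu_ n) (s_ n)) (mixture_density mu s) +
   L1dist (mixture_density mu s) f0 < e%:E)%E.
  have gap : 0 < e - fine (L1dist (mixture_density mu s) f0).
    by rewrite subr_gt0 -lte_fin fineK.
  have [N _ hN'] := cvge0_near_lt cv gap.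
  by exists N; have := hN' N (leqnn N); rewrite /= EFinB fineK// lteBrDr.
move=> hn; have [_ _] := hg n; apply; split; first exact: s_gt0.
apply: le_lt_trans hn; apply: L1dist_triangle; [exact: mm (s_gt0 n)|exact: mm s0|exact: mf0].
Qed.

(** * Continuous quantile functions *)

Lemma C01_of_within (m : R -> R) : {within I01, continuous m} ->
  exists mu : C01 R, forall x, I01 x -> C01_ext mu x = m x.
Proof.
move=> /subspace_sigL_continuousP cm.
pose mu : C01 R := (mkcts cm : continuousType (unit_itv R) R).
exists mu => x x01; pose z : unit_itv R := SigSub (mem_set x01).
have -> : C01_ext mu x = mu z by rewrite -C01_extE SubK.
by have -> : x = \val z by rewrite SubK.
Qed.

(** Integrating from [a - 1] instead of [a] makes [F] differentiable at [a]
    too, so that no one-sided derivative is needed there. *)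
Lemma continuous_primitive (g : R -> R) (a b : R) : a < b -> continuous g ->
  exists F : R -> R, [/\ F a = 0,
    (F b)%:E = (\int[leb]_(t in `[a, b]) (g t)%:E)%E,
    forall x, a <= x -> derivable F x 1 & forall x, a <= x -> 
      (\forall z \near x, derive1 F z = g z)].
Proof.
move=> ab cg.
have ig c u : leb.-integrable `[c, u] (EFin \o g).
  apply: continuous_compact_integrable; first exact: segment_compact.
  exact: continuous_subspaceT.
pose G x := \int[leb]_(t in `[a - 1, x]) g t.
have G1 x : a - 1 < x -> derivable G x 1 /\ derive1 G x = g x.
  move=> ax; apply: (@continuous_FTC1_closed _ _ _ _ (x + 1)) => //.
  - by rewrite ltrDl.
  - exact: cg.
have F1 : forall x, a - 1 < x -> is_derive x 1 (G \- cst (G a)) (g x).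
  move=> x /G1[dG Gx]; apply: DeriveDef.
    by apply: derivableB; [exact: dG|exact: derivable_cst].
  by rewrite deriveB; [|exact: dG|exact: derivable_cst];
    rewrite derive_cst subr0 -derive1E.
exists (G \- cst (G a)); split.
- by rewrite /= subrr.
- rewrite /= /cst /G Rintegral_itvB ?bnd_simp; [|exact: ig|by rewrite gerBl|exact: ltW].
  rewrite Rintegral_itv_obnd_cbnd; last first.
    apply: integrableS (ig a b) => //; exact: subset_itv_oc_cc.
  by rewrite /Rintegral fineK//; apply: integrable_fin_num.
- move=> x ax; have [] := F1 x _ => //. 
  by apply: lt_le_trans ax; rewrite ltrBlDr ltrDl.
move=> x ax.
have : a - 1 < x by apply: lt_le_trans ax; rewrite ltrBlDr ltrDl.
move/lt_nbhsr; apply: filterS => z az.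
by have [_ <-] := F1 z az; rewrite derive1E.
Qed.

(** The quantile function of a continuous positive density on [[a, b]] is
    continuous, being the inverse of an increasing continuous primitive [F].
    The substitution [x = F t] turns its mixture into the convolution of the
    density with a normal kernel. *)
Lemma quantile_mixture (g : R -> R) (a b : R) : a < b -> continuous g ->
  (forall t, 0 < g t) -> (\int[leb]_(t in `[a, b]) (g t)%:E = 1)%E ->
  exists mu : C01 R, forall s y : R, s != 0 ->
    ((mixture_density mu s y)%:E =
     \int[leb]_(t in `[a, b]) (normal_pdf y s t * g t)%:E)%E.
Proof.
move=> ab cg g0 g1.
have [F [Fa Fb dF F'g]] := continuous_primitive ab cg.
have {}Fb : F b = 1 by apply: EFin_inj; rewrite Fb g1.
have F'E x : a <= x -> derive1 F x = g x.
  by move=> /F'g/nbhs_singleton.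
have F'cvg x : a <= x -> derive1 F z @[z --> x] --> g x.
  move=> ax; apply: (cvg_trans _ (cg x)); apply: near_eq_cvg.
  by apply: filterS (F'g _ ax) => z ->.
have cF x : a <= x -> F z @[z --> x] --> F x.
  move=> ax; apply: differentiable_continuous.
  by apply/derivable1_diffP; exact: dF.
have wF : {within `[a, b], continuous F}.
  apply: derivable_within_continuous => x.
  by rewrite in_itv /= => /andP[ax _]; exact: dF.
have Finc : {in `[a, b] &, {homo F : x y / x < y}}.
  move=> x y; rewrite !in_itv /= => /andP[ax _] /andP[_ yb] xy.
  apply: (@gtr0_derive1_incr R F a b) => // z; rewrite in_itv /= => /andP[/ltW az _].
    exact: dF.
  by rewrite F'E.
have Finj : {in `[a, b] &, injective F}.
  move=> x y xab yab Fxy; have [xy|xy|//] := ltgtP x y.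
    by have := Finc _ _ xab yab xy; rewrite Fxy ltxx.
  by have := Finc _ _ yab xab xy; rewrite Fxy ltxx.
pose m x := xget a [set t | t \in `[a, b] /\ F t = x].
have mK : {in `[a, b], cancel F m}.
  move=> t tab; rewrite /m; case: xgetP => [u _ [uab Fut]|]; first exact: Finj.
  by move=> /(_ t); case.
have wm : {within I01, continuous m}.
  by rewrite -Fa -Fb; exact: segment_can_le_continuous (ltW ab) wF mK.
have [mu mum] := C01_of_within wm.
exists mu => s y s0.
rewrite [mixture_density _ _ _]/(normal_mixture (C01_ext mu) s y).
rewrite normal_mixtureE//; last exact: measurable_C01_ext.
transitivity (\int[leb]_(x in `[F a, F b]) (normal_pdf 0 s (y - m x))%:E)%E.
  by rewrite Fa Fb; apply: eq_integral => x /set_mem x01; rewrite mum.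
rewrite (@integration_by_substitution_increasing R F
  (fun x => normal_pdf 0 s (y - m x)) a b) ?(ltW ab)//.
- apply: eq_integral => t /set_mem /= tab.
  rewrite !fctE /= mK// F'E; last by move: tab; rewrite in_itv /= => /andP[].
  by rewrite normal_pdf_sym.
- move=> x; rewrite in_itv /= => /andP[/ltW ax _].
  by rewrite /continuous_at F'E//; exact: F'cvg.
- by apply/cvg_ex; exists (g a); apply: cvg_at_right_filter; exact: F'cvg.
- apply/cvg_ex; exists (g b); apply: cvg_at_left_filter.
  by apply: F'cvg; exact: ltW.
- split.
  + by move=> x; rewrite in_itv /= => /andP[/ltW ax _]; exact: dF.
  + by apply: cvg_at_right_filter; exact: cF.
  + by apply: cvg_at_left_filter; apply: cF; exact: ltW.
- rewrite Fa Fb.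
  apply: (@within_continuous_comp _ _ _ _ m (fun u => normal_pdf 0 s (y - u))) => //.
  move=> u _; apply: (@continuous_comp _ _ _ (fun u => y - u) (normal_pdf 0 s)).
    by apply: continuousB; [exact: cst_continuous|exact: cvg_id].
  exact: continuous_normal_pdf.
Qed.

(** * Approximating an arbitrary density *)

Lemma measurable_patch_itv (f : R -> R) (a b : R) : measurable_fun setT f ->
  measurable_fun setT (f \_ `[a, b]).
Proof.
move=> mf.
have := measurable_funS measurableT (@subsetT _ `[a, b]%classic) mf.
by move/(measurable_restrictT f (measurable_itv _)).
Qed.

Lemma ae_neq2 (a b : R) (P : set R) : (forall y, y != a -> y != b -> P y) ->
  {ae leb, forall y, P y}.
Proof.
move=> Pab; exists ([set a] `|` [set b]); split.
- by apply: measurableU; exact: measurable_set1.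
- apply: countable_lebesgue_measure0; apply: finite_set_countable.
  by rewrite finite_setU; split; exact: finite_set1.
move=> y /= nPy; have [->|ya] := eqVneq y a; first by left.
by have [->|yb] := eqVneq y b; [right|case: nPy; exact: Pab].
Qed.

(** Cutting [g] off outside [[a, b]] creates discontinuities at the two
    endpoints only, a null set in the pointwise limit below. *)
Lemma continuous_patch_itv (g : R -> R) (a b y : R) : continuous g ->
  y != a -> y != b -> {for y, continuous (g \_ `[a, b])}.
Proof.
move=> cg ya yb; rewrite /prop_for /continuous_at.
have [yab|yNab] := boolP (y \in `[a, b]).
  have {}yab : y \in `]a, b[.
    by move: yab; rewrite !in_itv /= !lt_neqAle (eq_sym a) ya yb.
  have gE z : z \in `]a, b[ -> (g \_ `[a, b]) z = g z.
    by move=> zab; rewrite patchE ifT// inE /=; exact: subset_itv_oo_cc.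
  rewrite gE//; apply: cvg_trans (cg y); apply: near_eq_cvg.
  by apply: filterS (near_in_itvoo yab) => z zab; rewrite gE.
have gE z : z \notin `[a, b] -> (g \_ `[a, b]) z = 0.
  by move=> zab; rewrite patchE ifF//; apply/negbTE; rewrite notin_setE; exact/negP.
rewrite gE//; have c0 : (fun=> 0 : R) @ y --> (0 : R) by exact: cvg_cst.
apply: cvg_trans c0; apply: near_eq_cvg.
move: yNab; rewrite in_itv /= negb_and -!ltNge => /orP[h|h].
  apply: filterS (lt_nbhsl h) => z za; rewrite gE// in_itv /=.
  by rewrite negb_and -ltNge za.
apply: filterS (lt_nbhsr h) => z za; rewrite gE// in_itv /=.
by rewrite negb_and -!ltNge za orbT.
Qed.

(** With [mu] the quantile function, the mixture is the smoothing of
    [g \_ `[a, b]]. It converges to that density at every point other than [a]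
    and [b] as the scale tends to zero, hence in L1 by Scheffe's lemma. *)
Lemma mixture_approx_continuous (g : R -> R) (a b : R) : a < b ->
  continuous g -> (forall t, 0 < g t) ->
  (\int[leb]_(t in `[a, b]) (g t)%:E = 1)%E ->
  exists mu : C01 R, forall e, 0 < e ->
    exists2 s, 0 < s & (L1dist (mixture_density mu s) (g \_ `[a, b]) < e%:E)%E.
Proof.
move=> ab cg g0 g1; have [mu muE] := quantile_mixture ab cg g0 g1.
exists mu => e e0.
pose h := g \_ `[a, b].
have mh : measurable_fun setT h.
  by apply: measurable_patch_itv; exact: continuous_measurable_fun.
have h0 t : 0 <= h t by rewrite /h patchE; case: ifP => // _; exact: ltW.
have dh : is_density h.
  split => //; rewrite -g1 [in RHS]integral_mkcond; apply: eq_integral => t _.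
  by rewrite /h restrict_EFin.
have [K hK] : exists K, forall t, `|h t| <= K.
  have [c _ gc] := EVT_max (ltW ab) (continuous_subspaceT cg).
  exists (g c) => t; rewrite ger0_norm// /h patchE; case: ifP => [|_].
    by rewrite inE; exact: gc.
  exact: ltW.
pose s_ n : R := n.+1%:R^-1.
have s_gt0 n : 0 < s_ n by rewrite /s_ invr_gt0.
have s_cvg : s_ @ \oo --> (0 : R) by exact: cvg_harmonic.
have cv : (L1dist (mixture_density mu (s_ n)) h @[n --> \oo] --> 0)%E.
  apply: scheffe => //.
    by move=> n; exact: mixture_density_is_density.
  apply: (@ae_neq2 a b) => y ya yb.
  have := normal_smoothing_cvg mh hK (continuous_patch_itv cg ya yb) s_gt0 s_cvg.
  have E n : (\int[leb]_t (normal_pdf y (s_ n) t * h t)%:E)%E =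
      (mixture_density mu (s_ n) y)%:E.
    rewrite muE ?gt_eqF// [RHS]integral_mkcond; apply: eq_integral => t _.
    by rewrite /h !patchE; case: ifP => // _; rewrite mulr0.
  by under eq_fun do rewrite E; move/fine_cvg.
have [n _ /(_ n (leqnn n)) hn] := cvge0_near_lt cv e0.
by exists (s_ n).
Qed.

Lemma truncation_L1_cvg (f : R -> R) : is_density f ->
  (L1dist (f \_ `[- n.+1%:R, n.+1%:R]%classic%R) f @[n --> \oo] --> 0)%E.
Proof.
move=> df; have [mf f0 _] := df.
have [] := @dominated_convergence _ _ R leb setT measurableT
  (fun n => EFin \o (f \_ `[- n.+1%:R, n.+1%:R]%classic%R)) (EFin \o f) (EFin \o f).
- by move=> n; apply/measurable_EFinP; exact: measurable_patch_itv.
- exact/measurable_EFinP.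
- apply: aeW => x _ /=; apply: cvg_EFin; first exact: nearW.
  have cf : (fun=> f x : R) @ \oo --> f x by exact: cvg_cst.
  apply: cvg_trans cf; apply: near_eq_cvg.
  apply: filterS (nbhs_infty_ger `|x|) => n /= xn.
  rewrite patchE ifT// inE /= in_itv /= -ler_norml (le_trans xn)//.
  by rewrite ler_nat.
- exact: density_integrable.
- apply: aeW => x n _ /=; rewrite lee_fin patchE; case: ifP => _.
    by rewrite ger0_norm.
  by rewrite normr0.
by [].
Qed.

Lemma L1dist_patch (f g : R -> R) (a b : R) :
  L1dist (f \_ `[a, b]) (g \_ `[a, b]) =
  (\int[leb]_(x in `[a, b]) `|f x - g x|%:E)%E.
Proof.
rewrite [RHS]integral_mkcond; apply: eq_integral => x _.
by rewrite !patchE; case: ifP => // _; rewrite subrr normr0.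
Qed.

(** Truncate [f] to a large segment, approximate it there in L1 by a
    continuous function, raise the approximant to a small level [eta] to make
    it positive, and normalise. The mass before normalisation differs from
    that of [f] by at most the L1 error, so normalising costs no more than
    the error already made. *)
Lemma density_approx_continuous (f : R -> R) (e : R) : is_density f -> 0 < e ->
  exists a b (g : R -> R), [/\ a < b, continuous g, forall t, 0 < g t,
    (\int[leb]_(t in `[a, b]) (g t)%:E = 1)%E &
    (L1dist (g \_ `[a, b]) f < e%:E)%E].
Proof.
move=> df e0; have [mf f0 intf] := df.
(* Truncating, approximating and raising to [eta] cost [d] each, and
   normalising as much again: [6 * d] in all, less than [e]. *)
pose d := e / 7; have d0 : 0 < d by rewrite /d divr_gt0.
have [N _ /(_ N (leqnn N))] := cvge0_near_lt (truncation_L1_cvg df) d0.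
set b := N.+1%:R; set a := - b => trunc.
have b0 : 0 < b by rewrite /b.
have ab : a < b by rewrite /a gtrN.
have lab : leb `[a, b]%classic = (b - a)%:E.
  by rewrite lebesgue_measure_itv /= lte_fin ab.
have intfab : leb.-integrable `[a, b] (EFin \o f).
  by apply: integrableS (density_integrable df).
have labfin : (leb `[a, b]%classic < +oo)%E by rewrite lab ltry.
have [k_ [ck _ kcvg]] := approximation_continuous_integrable
  (measurable_itv _) labfin intfab.
have [n _ /(_ n (leqnn n)) hk] := cvge0_near_lt kcvg d0.
pose k := k_ n.
pose eta := d / (b - a).
have eta0 : 0 < eta by rewrite /eta divr_gt0 ?subr_gt0.
pose g t := Num.max (k t) eta.
have cg : continuous g.
  by move=> t; apply: (@continuous_max R R k (cst eta)); [exact: ck|exact: cst_continuous].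
have g_eta t : eta <= g t by rewrite /g le_max lexx orbT.
have g0 t : 0 < g t by exact: lt_le_trans (g_eta t).
have mg : measurable_fun setT g by exact: continuous_measurable_fun.
have mk : measurable_fun setT k by exact: (continuous_measurable_fun (ck n)).
have mgab := measurable_patch_itv a b mg.
have mfab := measurable_patch_itv a b mf.
have fg t : `|g t - f t| <= `|f t - k t| + eta.
  rewrite /g; have := f0 t; have [h|h] := leP (k t) eta => ft.
    rewrite ler_norml; apply/andP; split.
      by have := ler_norm (f t - k t); lra.
    by have := normr_ge0 (f t - k t); lra.
  by rewrite distrC lerDl ltW.
have gf3 : (L1dist (g \_ `[a, b]) f <= (3 * d)%:E)%E.
  apply: le_trans (L1dist_triangle mgab mfab mf) _.
  rewrite (_ : 3 * d = 2 * d + d); last by ring.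
  rewrite EFinD; apply: leeD; last exact: ltW.
  rewrite L1dist_patch.
  have mN (u v : R -> R) (E : set R) : measurable_fun setT u -> measurable_fun setT v ->
      measurable_fun E (fun t => `|u t - v t|).
    move=> mu mv; apply: measurable_funS measurableT (@subsetT _ _) _ => //.
    by apply: measurableT_comp => //; exact: measurable_funB.
  apply: (@le_trans _ _ (\int[leb]_(t in `[a, b]) (`|f t - k t|%:E + eta%:E))%E).
    apply: ge0_le_integral => //.
    - by apply/measurable_EFinP; exact: mN.
    - apply: emeasurable_funD => //; apply/measurable_EFinP; exact: mN.
    - by move=> t _; rewrite -EFinD lee_fin.
  rewrite ge0_integralD//; last 2 first.
  - by apply/measurable_EFinP; exact: mN.
  - by move=> t _; rewrite lee_fin ltW.
  rewrite integral_cst//= lab -EFinM /eta divfK; last by rewrite subr_eq0 gt_eqF.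
  rewrite (_ : 2 * d = d + d); last by ring.
  by rewrite EFinD; apply: leeD => //; exact: ltW.
have ig : leb.-integrable `[a, b] (EFin \o g).
  apply: continuous_compact_integrable; first exact: segment_compact.
  exact: continuous_subspaceT.
have igT : leb.-integrable setT (EFin \o (g \_ `[a, b])).
  by rewrite -restrict_EFin; apply/(integrable_mkcond _ _).1.
pose c := fine (\int[leb]_(t in `[a, b]) (g t)%:E)%E.
have cE : (c%:E = \int[leb]_(t in `[a, b]) (g t)%:E)%E.
  by rewrite /c fineK//; exact: integrable_fin_num.
have cT : (c%:E = \int[leb]_t ((g \_ `[a, b]) t)%:E)%E.
  rewrite cE [LHS]integral_mkcond; apply: eq_integral => t _.
  by rewrite restrict_EFin.
have c0 : 0 < c.
  rewrite -lte_fin cE; apply: (@lt_le_trans _ _ (\int[leb]_(t in `[a, b]) eta%:E)%E).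
    by rewrite integral_cst//= lab -EFinM lte_fin mulr_gt0// subr_gt0.
  apply: ge0_le_integral => //.
  - by move=> t _; rewrite lee_fin ltW.
  - exact: measurable_int ig.
  - by move=> t _; rewrite lee_fin.
have c1 : `|1 - c| <= 3 * d.
  rewrite -lee_fin -abse_EFin EFinB cT -intf; apply: le_trans gf3.
  rewrite -integralB//; [|exact: density_integrable].
  apply: le_trans (le_abse_integral _ _ _) _ => //.
    by apply: emeasurable_funB; exact/measurable_EFinP.
  by rewrite L1distC.
exists a, b, (fun t => c^-1 * g t); split => //.
- by move=> t; apply: cvgM; [exact: cvg_cst|exact: cg].
- by move=> t; rewrite mulr_gt0// invr_gt0.
- under eq_integral do rewrite EFinM.
  by rewrite integralZl// -cE -EFinM mulVf// gt_eqF.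
apply: le_lt_trans (L1dist_triangle _ mgab mf) _.
  apply: measurable_patch_itv; exact: measurable_funM.
have -> : L1dist ((fun t => c^-1 * g t) \_ `[a, b]) (g \_ `[a, b]) = `|1 - c|%:E.
  rewrite L1dist_patch.
  transitivity (\int[leb]_(t in `[a, b]) (`|c^-1 - 1|%:E * (g t)%:E))%E.
    apply: eq_integral => t _; rewrite -EFinM; congr EFin.
    by rewrite -[X in _ - X]mul1r -mulrBl normrM (gtr0_norm (g0 t)).
  rewrite integralZl// -cE -EFinM; congr EFin.
  by rewrite -[X in _ * X](gtr0_norm c0) -normrM mulrBl mulVf ?gt_eqF// mul1r.
apply: (@le_lt_trans _ _ ((3 * d)%:E + (3 * d)%:E))%E.
  by apply: leeD.
by rewrite -EFinD lte_fin /d; lra.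
Qed.

(** * Positive mass of neighbourhoods *)

Lemma sup_norm_ub (h : unit_itv R -> R) : continuous h ->
  forall x, `|h x| <= sup_norm h.
Proof.
move=> ch x; apply: ub_le_sup; last by exists x.
have cnh : continuous (fun x : unit_itv R => `|h x|).
  by move=> z; apply: (@continuous_comp _ _ _ h (fun y : R => `|y|));
    [exact: ch|exact: norm_continuous].
move/(@subspace_valL_continuousP' _ _ _ (0 : R)) : cnh => cnh.
have [c _ cmax] := EVT_max (@ler01 R) cnh.
exists ('valL_0 (fun x : unit_itv R => `|h x|) c) => _ [z _ <-].
have zin : \val z \in `[0, 1]%R by have := set_valP z.
apply: le_trans (cmax _ zin).
by rewrite -[leLHS](congr1 (@^~ z)
  (valLK (0 : R) (fun t : unit_itv R => `|h t|))).
Qed.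

Lemma C01_sub_continuous (f g : C01 R) : continuous (f \- g : unit_itv R -> R).
Proof.
move=> x; apply: (@continuousB R R _ f g x); exact: C01_continuous.
Qed.

Lemma sup_norm_le (h : unit_itv R -> R) (r : R) :
  (forall x, `|h x| <= r) -> sup_norm h <= r.
Proof.
move=> hr; apply: ge_sup => [|_ [x _ <-]//].
have h0 : (0 : R) \in (`[0, 1]%classic : set R).
  by rewrite inE /= in_itv /= lexx ler01.
by exists `|h (SigSub h0)|; exists (SigSub h0).
Qed.

(** Needed for the measurability of sup-norm balls. *)
Lemma open_sup_ball (mu : C01 R) (e : R) :
  open [set nu : C01 R | sup_norm (nu \- mu) < e].
Proof.
rewrite openE => nu /= nue; apply/C01_nbhsP.
exists (e - sup_norm (nu \- mu)); first by rewrite subr_gt0.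
move=> ka /= kae; apply: le_lt_trans (_ : sup_norm (ka \- nu) + sup_norm (nu \- mu) < e).
  apply: sup_norm_le => x.
  apply: le_trans (ler_distD (nu x) _ _) _.
  by apply: lerD; [exact: (sup_norm_ub (@C01_sub_continuous ka nu))|
                  exact: (sup_norm_ub (@C01_sub_continuous nu mu))].
by rewrite -ltrBrDr.
Qed.

Import HBNNSimple.

(** Only the sections of [A] have to be measurable: the product measure of [A]
    is an integral of section masses, and the integral of a nonnegative
    function, measurable or not, is the supremum over the simple functions
    below it. The simple function equal to [Q V] on [U] is one of them. This
    avoids comparing the product of the Borel sigma-algebras with the Borel
    sigma-algebra of the product. *)
Lemma product_measure1_rectangle_gt0 (d1 d2 : measure_display) (T1 : measurableType d1)
    (T2 : measurableType d2) (P : probability T1 R) (Q : probability T2 R)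
    (A : set (T1 * T2)) (U : set T1) (V : set T2) :
  measurable U -> measurable V -> (0 < P U)%E -> (0 < Q V)%E ->
  (forall x, measurable (xsection A x)) -> U `*` V `<=` A ->
  (0 < (P \x Q) A)%E.
Proof.
move=> mU mV PU QV mA UVA.
have hr : (0 <= fine (Q V)) by rewrite fine_ge0.
pose h := scale_nnsfun (indic_nnsfun R mU) hr.
apply: (@lt_le_trans _ _ (\int[P]_x (h x)%:E)%E).
  rewrite [ltRHS](_ : _ = \int[P]_x ((fine (Q V))%:E * (\1_U x)%:E))%E; last first.
    by apply: eq_integral => x _; rewrite -EFinM.
  rewrite ge0_integralZl//; last first.
    by apply/measurable_EFinP; exact: measurable_indic.
  rewrite integral_indic// setIT mule_gt0//.
  by rewrite lte_fin fine_gt0// QV ltey_eq fin_num_measure.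
rewrite integralT_nnsfun /product_measure1 ge0_integralTE; last by [].
apply: ereal_sup_ubound; exists h => // x /=.
rewrite mindicE; have [xU|xU] := boolP (x \in U); last by rewrite mulr0.
rewrite mulr1 fineK ?fin_num_measure//.
apply: le_measure; rewrite ?inE//.
by move=> y Vy; rewrite /xsection /= inE; apply: UVA; split => //; rewrite inE in xU.
Qed.

End mixtures.

Theorem theorem4p1 (R : realType)
    (Pmu : probability (borel (C01 R)) R)
    (Psigma : probability (borel (nonneg_itv R)) R)
    (Pmu_full : sup_full_support Pmu) (Psigma_full : full_support Psigma)
    (f0 : R -> R) (f0_density : is_density f0)
    (f0_moment : finite_first_moment f0)
    (f0_nonzero : nonzero_ae_on_support f0) :
  L1_support (induced_prior Pmu Psigma) f0.
Proof.
have [mf0 _ _] := f0_density.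
move=> e e0; rewrite /induced_prior.
set A := [set p : C01 R * nonneg_itv R | _].
have e20 : 0 < e / 2 by rewrite divr_gt0.
have [a [b [g [ab cg g0 g1 gf]]]] := density_approx_continuous f0_density e20.
have [mu /(_ _ e20)[s s0 mug]] := mixture_approx_continuous ab cg g0 g1.
have mgab := measurable_patch_itv a b (continuous_measurable_fun cg).
have muf : (L1dist (mixture_density mu s) f0 < e%:E)%E.
  have [mm _ _] := mixture_density_is_density mu s0.
  apply: le_lt_trans (L1dist_triangle mm mgab mf0) _.
  by rewrite [e in ltRHS]splitr EFinD; exact: lteD.
have [d d0 near] := mixture_density_near mf0 s0 muf.
pose U := [set nu : C01 R | sup_norm (nu \- mu) < d].
pose V := [set t : nonneg_itv R | `|\val t - s| < d].
have cval : continuous (\val : nonneg_itv R -> R) by exact: initial_continuous.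
have open_val (B : set R) : open B -> open (\val @^-1` B : set (nonneg_itv R)).
  by move=> oB; apply: open_comp => // x _; exact: cval.
have oV : open V.
  rewrite (_ : V = \val @^-1` (ball s d)); first by apply: open_val; exact: ball_open.
  by apply/seteqP; split => t /=; rewrite /V /= /ball /= distrC.
have sP : s \in (`[0, +oo[%classic : set R) by rewrite inE /= in_itv /= (ltW s0).
have mb (T : ptopologicalType) (B : set T) : open B -> measurable (B : set (borel T)).
  by move=> oB; apply: sub_sigma_algebra.
apply: (@product_measure1_rectangle_gt0 R _ _ (borel (C01 R))
  (borel (nonneg_itv R)) Pmu Psigma A U V).
- by apply: mb; exact: open_sup_ball.
- exact: mb.
- exact: Pmu_full.
- by apply: Psigma_full => //; exists (SigSub sP); rewrite /V /= subrr normr0.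
(* A section of [A] is open: apply the openness in the scale alone. *)
- move=> nu.
  apply: mb.
  rewrite openE => t.
  rewrite /xsection /=.
  move=> /set_mem[/= t0 tf].
  have [r r0 nr] := mixture_density_near mf0 t0 tf.
  apply: (@filterS _ (nbhs t) _ (\val @^-1` ball (\val t) r)); last first.
    by apply: cval; exact: nbhsx_ballx.
  move=> u /= ur; rewrite inE /A /=; apply: nr.
    by move=> x; rewrite subrr normr0.
  by rewrite distrC.
- move=> [nu t] [/= nuU tV]; apply: near => //.
  move=> x; apply: le_lt_trans nuU.
  exact: (sup_norm_ub (@C01_sub_continuous R nu mu)).
Qed.
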